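(* For every term $\theta$ of Stochastic Differential Dynamic Logic, every interpretation $I$ and every state $z$, the map $\omega \mapsto Iz\llbracket\theta\rrbracket(\omega)$, $\Omega \to \mathbb{R}_\bot$, is measurable.
   Context: Let $\mathbb{R}_\bot=\mathbb{R}\cup\{\bot\}$, where $\bot$ (''undefined'') is absorbing for $+$ and $*$. Give it the topology generated by the open sets of $\mathbb{R}$ together with $\{\bot\}$, and its Borel $\sigma$-algebra. Let $V$ be a countable set of variables, closed under forming $x_t$ and $x_{B,y}$ for $x,y\in V$. Let $\widehat{\mathbb{R}_\bot^V}$ be the set of maps $V\to\mathbb{R}_\bot$ that equal $\bot$ at all but finitely many variables. Let $\mathrm{Val}=\widehat{\mathbb{R}_\bot^V}\cup\{\triangledown,\triangle\}$, where $\triangledown$ means ''crashed'' and $\triangle$ means ''left the evolution domain''. Val is a measurable space, with measurability induced from $\mathbb{R}_\bot$ on the coordinates together with the two extra points. Fix a probability space $(\Omega,\mathcal F,\mathcal P)$ with a filtration, a family of Brownian motions $W$ (so Itô integrals are defined) and a family of i.i.d. uniform $[0,1]$ random variables. A state is a measurable map $z:\Omega\to\mathrm{Val}$. Terms are $\theta,\kappa ::= c \mid x \mid \theta*\kappa \mid \theta+\kappa \mid f_d(\theta_1,\dots,\theta_d) \mid d_t(\theta) \mid d_{B,x}(\theta) \mid \iota i\,\phi_d$. Here $c$ is a real constant, $x\in V$, and $f_d$ is a $d$-ary function symbol. In $\iota i\,\phi_d$ we have $i\in\{1,\dots,d\}$, and $\phi_d$ is a formula with no program or predicate symbols that contains $d$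 special variables $\diamond_1,\dots,\diamond_d$. Formulas are built from $\theta\ge\kappa$, $\neg$, $\wedge$ and $\mathrm{sure}(\cdot)$; for such formulas without programs or predicate symbols the semantics is as follows. $\theta\ge\kappa$ is true if $a-b\ge0$, false if $a-b<0$, and indeterminate if $a-b=\bot$, where $a,b$ are the values of $\theta,\kappa$. Truth values are $\ominus<\oslash<\oplus$. Negation swaps $\oplus$ and $\ominus$. Conjunction is the minimum. $\mathrm{sure}(\phi)$ is $\oplus$ if $\phi$ is $\oplus$ and $\ominus$ otherwise. An interpretation $I$ assigns a measurable $If_d:\mathbb{R}_\bot^d\to\mathbb{R}_\bot$ to each function symbol (plus data for predicate and program symbols and a countable set of stop times, irrelevant here). Term semantics $Iv\llbracket\theta\rrbracket\in\mathbb{R}_\bot$ for $v\in\widehat{\mathbb{R}_\bot^V}$: - $Iv\llbracket c\rrbracket=c$ and $Iv\llbracket x\rrbracket=v(x)$. - Sums and products are taken pointwise. - $Iv\llbracket f_d(\theta_1,\dots,\theta_d)\rrbracket=If_d(Iv\llbracket\theta_1\rrbracket,\dots,Iv\llbracket\theta_d\rrbracket)$. - Write $\widehat{I\theta}$ for $v\mapsto Iv\llbracket\theta\rrbracket$. - For $e\in\{\iota i\,\phi_d,\ d_t\theta,\ d_{B,x}\theta\}$, define a candidate function $\mathit{Can}(I,e):\widehat{\mathbb{R}_\bot^V}\to\mathbb{R}_\bot$, and set $Iv\llbracket e\rrbracket=\mathit{Can}(I,e)(v)$ if $\mathit{Can}(I,e)$ is measurable, and $\bot$ otherwise. The candidates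 are: - $\mathit{Can}(I,\iota i\,\phi_d)(v)=u(\diamond_i)$ if there is a unique $u\in\widehat{\mathbb{R}_\bot^V}$ agreeing with $v$ off $\{\diamond_1,\dots,\diamond_d\}$ with $\phi_d$ true at $u$, and $\bot$ otherwise. - $\mathit{Can}(I,d_t\theta)=\sum_{x\in V}x_t\frac{\partial\widehat{I\theta}}{\partial x}+\frac12\sum_{x,y\in V}\frac{\partial^2\widehat{I\theta}}{\partial x\partial y}\sum_{j\in V}x_{B,j}y_{B,j}$, evaluated at $v$. - $\mathit{Can}(I,d_{B,x}\theta)=\sum_{y\in V}\frac{\partial\widehat{I\theta}}{\partial y}y_{B,x}$, evaluated at $v$. - The last two are $\bot$ where the derivatives are undefined. On $\triangledown$ and $\triangle$ every term has value $\bot$. For a state $z$, $Iz\llbracket\theta\rrbracket(\omega):=I\,z(\omega)\llbracket\theta\rrbracket$. *)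

(* Defs.v *)
From HB Require Import structures.
From mathcomp Require Import all_boot all_order all_algebra finmap.
From mathcomp Require Import all_classical all_reals all_analysis.
Import Order.TTheory GRing.Theory Num.Theory.
Import numFieldNormedType.Exports.

Set Implicit Arguments.
Unset Strict Implicit.
Unset Printing Implicit Defensive.

Local Open Scope classical_set_scope.
Local Open Scope ring_scope.

(* [None] is the undefined value. *)
Definition Rbot (R : realType) : Type := option R.

Section Rbot_structures.
Context (R : realType).

HB.instance Definition _ := Choice.on (Rbot R).
HB.instance Definition _ := isPointed.Build (Rbot R) (None : option R).

Definition Rbot_subbase : set (set (Rbot R)) :=
  [set U | (exists2 O : set R, open O & U = Some @` O) \/ U = [set None]].

HB.instance Definition _ :=
  @isSubBaseTopological.Build (Rbot R) (set (Rbot R)) Rbot_subbase id.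

Definition Rbot_borel : set (set (Rbot R)) := <<s [set U : set (Rbot R) | open U] >>.

Let Rbot_borel_sigma : sigma_algebra setT Rbot_borel.
Proof. exact: smallest_sigma_algebra. Qed.

Let Rbot_borel0 : Rbot_borel set0.
Proof. by case: Rbot_borel_sigma. Qed.

Let Rbot_borelC A : Rbot_borel A -> Rbot_borel (~` A).
Proof. by case: Rbot_borel_sigma => _ C _; rewrite -setTD; exact: C. Qed.

Let Rbot_borel_bigcup (F : (set (Rbot R))^nat) :
  (forall i, Rbot_borel (F i)) -> Rbot_borel (\bigcup_i F i).
Proof. by case: Rbot_borel_sigma => _ _; exact. Qed.

HB.instance Definition _ := @isMeasurable.Build default_measure_display
  (Rbot R) Rbot_borel Rbot_borel0 Rbot_borelC Rbot_borel_bigcup.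

Definition bot : Rbot R := None.
Definition real_ (r : R) : Rbot R := Some r.

Definition rbadd (a b : Rbot R) : Rbot R :=
  if a is Some r then if b is Some s then Some (r + s) else None else None.

Definition rbmul (a b : Rbot R) : Rbot R :=
  if a is Some r then if b is Some s then Some (r * s) else None else None.

Definition rbsub (a b : Rbot R) : Rbot R := rbadd a (rbmul (real_ (-1)) b).

Let rbaddA : associative rbadd.
Proof. by move=> [a|] [b|] [c|] //=; rewrite addrA. Qed.

Let rbaddC : commutative rbadd.
Proof. by move=> [a|] [b|] //=; rewrite addrC. Qed.

Let rbadd0 : left_id (real_ 0) rbadd.
Proof. by move=> [a|] //=; rewrite add0r. Qed.

HB.instance Definition _ :=
  Monoid.isComLaw.Build (Rbot R) (real_ 0) rbadd rbaddA rbaddC rbadd0.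

(* A sum over an infinite index set is undefined; see [dependent] for why this
   is the right value for the sums below. *)
Definition rbsum (I : choiceType) (A : set I) (a : I -> Rbot R) : Rbot R :=
  if `[< finite_set A >]
  then \big[rbadd/real_ 0]_(i <- fset_set A) a i else bot.

End Rbot_structures.

Arguments bot {R}.

(* The maps [vt], [vB] form x_t and x_{B,y}; they need not be injective, nor avoid
   the special variables. [diamond k] is the special variable
   with (1-based) index k.+1, so a formula of arity d may use [diamond i] with
   i < d. *)
Record variables := Variables {
  var :> countType;
  vt : var -> var;
  vB : var -> var -> var;
  diamond : nat -> var;
  diamond_inj : injective diamond }.

Record hat (R : realType) (V : variables) := Hat {
  hat_val :> V -> Rbot R;
  hat_fin : finite_set [set x | hat_val x <> bot] }.

Section hat_structures.
Context (R : realType) (V : variables).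

HB.instance Definition _ := gen_eqMixin (hat R V).
HB.instance Definition _ := gen_choiceMixin (hat R V).

Let undefined_fin : finite_set [set x : V | (fun=> bot : Rbot R) x <> bot].
Proof. by rewrite (_ : mkset _ = set0) // -subset0 => x; exact. Qed.

HB.instance Definition _ := isPointed.Build (hat R V) (Hat undefined_fin).

Definition hat_cylinders : set (set (hat R V)) :=
  \bigcup_(x : V)
    preimage_set_system setT (fun v : hat R V => v x) (@measurable _ (Rbot R)).

Definition hat_measurable : set (set (hat R V)) := <<s hat_cylinders >>.

Let hat_sigma : sigma_algebra setT hat_measurable.
Proof. exact: smallest_sigma_algebra. Qed.

Let hat_measurable0 : hat_measurable set0.
Proof. by case: hat_sigma. Qed.

Let hat_measurableC A : hat_measurable A -> hat_measurable (~` A).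
Proof. by case: hat_sigma => _ C _; rewrite -setTD; exact: C. Qed.

Let hat_measurable_bigcup (F : (set (hat R V))^nat) :
  (forall i, hat_measurable (F i)) -> hat_measurable (\bigcup_i F i).
Proof. by case: hat_sigma => _ _; exact. Qed.

HB.instance Definition _ := @isMeasurable.Build default_measure_display
  (hat R V) hat_measurable hat_measurable0 hat_measurableC hat_measurable_bigcup.

Definition upd_fun (v : hat R V) (x : V) (a : Rbot R) : V -> Rbot R :=
  fun y => if y == x then a else v y.

Lemma upd_fin v x a : finite_set [set y | upd_fun v x a y <> bot].
Proof.
apply: (@sub_finite_set _ _ (x |` [set y | v y <> bot])).
  by move=> y /=; rewrite /upd_fun; case: eqP => [->|_]; [left|right].
by rewrite finite_setU; split; [exact: finite_set1|exact: hat_fin].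
Qed.

Definition upd (v : hat R V) (x : V) (a : Rbot R) : hat R V :=
  Hat (upd_fin v x a).

End hat_structures.

Inductive Val (R : realType) (V : variables) :=
| Running of hat R V
| Crashed
| LeftDomain.
Arguments Crashed {R V}.
Arguments LeftDomain {R V}.

Section Val_structures.
Context (R : realType) (V : variables).

HB.instance Definition _ := gen_eqMixin (Val R V).
HB.instance Definition _ := gen_choiceMixin (Val R V).
HB.instance Definition _ := isPointed.Build (Val R V) Crashed.

(* A set is measurable iff its trace on the valuations is: this is the disjoint
   union of the valuations with two measurable points. *)
Definition Val_measurable : set (set (Val R V)) :=
  image_set_system setT (@Running R V) measurable.

Let Val_sigma : sigma_algebra setT Val_measurable.
Proof. by apply: sigma_algebra_image; exact: sigma_algebra_measurable. Qed.

Let Val_measurable0 : Val_measurable set0.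
Proof. by case: Val_sigma. Qed.

Let Val_measurableC A : Val_measurable A -> Val_measurable (~` A).
Proof. by case: Val_sigma => _ C _; rewrite -setTD; exact: C. Qed.

Let Val_measurable_bigcup (F : (set (Val R V))^nat) :
  (forall i, Val_measurable (F i)) -> Val_measurable (\bigcup_i F i).
Proof. by case: Val_sigma => _ _; exact. Qed.

HB.instance Definition _ := @isMeasurable.Build default_measure_display
  (Val R V) Val_measurable Val_measurable0 Val_measurableC Val_measurable_bigcup.

End Val_structures.

(* [F d] is the type of d-ary function symbols. *)
Inductive term (R : realType) (V : variables) (F : nat -> Type) : Type :=
| TConst of R
| TVar of V
| TMul of term R V F & term R V F
| TAdd of term R V F & term R V F
| TFun d of F d & ('I_d -> term R V F)
| TDt of term R V F
| TDB of V & term R V F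
| TIota d of 'I_d & formula R V F
with formula (R : realType) (V : variables) (F : nat -> Type) : Type :=
| FGe of term R V F & term R V F
| FNot of formula R V F
| FAnd of formula R V F & formula R V F
| FSure of formula R V F.

Inductive truth := TFalse | TIndet | TTrue.

Definition tneg (a : truth) : truth :=
  match a with TFalse => TTrue | TIndet => TIndet | TTrue => TFalse end.

Definition tmin (a b : truth) : truth :=
  match a, b with
  | TFalse, _ | _, TFalse => TFalse
  | TIndet, _ | _, TIndet => TIndet
  | TTrue, TTrue => TTrue
  end.

Definition tsure (a : truth) : truth := if a is TTrue then TTrue else TFalse.

Definition tge (R : realType) (a b : Rbot R) : truth :=
  match rbsub a b with
  | Some r => if 0 <= r then TTrue else TFalse
  | None => TIndet
  end.

Record interpretation (R : realType) (F : nat -> Type) := Interpretation {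
  fint : forall d, F d -> d.-tuple (Rbot R) -> Rbot R;
  fint_measurable : forall d (f : F d), measurable_fun setT (fint f) }.

Section candidates.
Context (R : realType) (V : variables).
Implicit Types (f : hat R V -> Rbot R) (v : hat R V) (x y : V).

(* Defined only if x has a real value in v and f is real valued along x near v. *)
Definition pderiv f x v : Rbot R :=
  if v x is Some a then
    let g := fun r : R => f (upd v x (real_ r)) in
    let g0 := fun r : R => odflt 0 (g r) in
    if `[< (\forall r \near a, g r <> bot) /\ derivable g0 a 1 >]
    then real_ (derive1 g0 a) else bot
  else bot.

(* Sums over all variables are to be read as sums over the variables on which f
   depends: for any other variable the partial derivative of f is the zero
   function, and such a variable contributes no summand, although its
   differential is undefined for all but finitely many of them. If f depends on
   infinitely many variables, then one of them is undefined in v, the derivative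
   along it is undefined, and so is the sum. *)
Definition dependent f : set V :=
  [set x | exists v (a : Rbot R), f (upd v x a) <> f v].

(* Where f is undefined all its derivatives are; this is only needed when f
   depends on no variable. *)
Definition where_defined f (c : hat R V -> Rbot R) v : Rbot R :=
  if f v is Some _ then c v else bot.

(* The entry for (x, y) of the quadratic covariation of the noise. When
   the x_{B,j} are distinct variables, only finitely many of them are defined; an undefined coefficient contributes no noise. *)
Definition covariation v x y : Rbot R :=
  rbsum [set j | v (vB x j) <> bot /\ v (vB y j) <> bot]
    (fun j => rbmul (v (vB x j)) (v (vB y j))).

Definition can_dt f : hat R V -> Rbot R :=
  where_defined f (fun v => rbadd
    (rbsum (dependent f) (fun x => rbmul (v (vt x)) (pderiv f x v)))
    (rbmul (real_ 2^-1)
      (rbsum (dependent f `*` dependent f)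
        (fun p => rbmul (pderiv (pderiv f p.2) p.1 v)
                        (covariation v p.1 p.2))))).

Definition can_dB x f : hat R V -> Rbot R :=
  where_defined f (fun v =>
    rbsum (dependent f) (fun y => rbmul (pderiv f y v) (v (vB y x)))).

Definition iota_witness d (phi : hat R V -> truth) v (u : hat R V) : Prop :=
  (forall x, (forall k : 'I_d, x <> diamond V k) -> u x = v x) /\ phi u = TTrue.

Definition can_iota d (i : 'I_d) (phi : hat R V -> truth) v : Rbot R :=
  match pselect (exists! u : hat R V, iota_witness d phi v u) with
  | left h => hat_val (sval (cid h)) (diamond V i)
  | right _ => bot
  end.

Definition if_measurable (c : hat R V -> Rbot R) : hat R V -> Rbot R :=
  if `[< measurable_fun setT c >] then c else (fun=> bot).

End candidates.

Fixpoint tsem (R : realType) (V : variables) (F : nat -> Type)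
    (I : interpretation R F) (t : term R V F) : hat R V -> Rbot R :=
  match t with
  | TConst c => fun=> real_ c
  | TVar x => fun v => v x
  | TMul t1 t2 => fun v => rbmul (tsem I t1 v) (tsem I t2 v)
  | TAdd t1 t2 => fun v => rbadd (tsem I t1 v) (tsem I t2 v)
  | TFun d f ts => fun v => fint I f [tuple tsem I (ts i) v | i < d]
  | TDt t1 => if_measurable (can_dt (tsem I t1))
  | TDB x t1 => if_measurable (can_dB x (tsem I t1))
  | TIota d i phi => if_measurable (can_iota i (fsem I phi))
  end
with fsem (R : realType) (V : variables) (F : nat -> Type)
    (I : interpretation R F) (p : formula R V F) : hat R V -> truth :=
  match p with
  | FGe t1 t2 => fun v => tge (tsem I t1 v) (tsem I t2 v)
  | FNot p1 => fun v => tneg (fsem I p1 v)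
  | FAnd p1 p2 => fun v => tmin (fsem I p1 v) (fsem I p2 v)
  | FSure p1 => fun v => tsure (fsem I p1 v)
  end.

Definition vsem (R : realType) (V : variables) (F : nat -> Type)
    (I : interpretation R F) (t : term R V F) (w : Val R V) : Rbot R :=
  if w is Running v then tsem I t v else bot.

(* Main.v *)
(* Induction on the term. The operators that could fail to be measurable (the
   differentials and definite description) are cut off by [if_measurable], so
   only sums, products and function symbols remain. Sums and products reduce to
   those of R, since [option R] is measurably the disjoint sum of R and a point. *)

Require Import Defs.
From mathcomp Require Import all_boot all_order all_algebra finmap.
From mathcomp Require Import all_classical all_reals all_analysis measurable_realfun.
Import numFieldNormedType.Exports.

Local Open Scope classical_set_scope.

Section measurable_Rbot.
Context (R : realType).

(** Continuity of the embedding of the reals: an open set is a union of finite intersections of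
    subbasic sets, and a subbasic set pulls back to an open set of reals or, for the undefined
    point, to the empty set. *)
Lemma open_real_preimage (U : set (Rbot R)) :
  open U -> open (@real_ R @^-1` U).
Proof.
move=> [D' sD' <-]; rewrite preimage_bigcup; apply: bigcup_open => A /sD'.
move=> [D sD <-]; rewrite preimage_bigcap openE => r Dr.
(* Neighbourhoods of [r] are stable under finite intersection, so one subbasic set [B] at a time is
   enough. *)
apply: filter_bigI => B DB; apply: open_nbhs_nbhs; split; last exact: Dr.
have /sD := DB; rewrite inE => -[[W oW ->] | ->] /=.
- by rewrite (_ : _ @^-1` _ = W)//; apply/seteqP; split=> [x [y Wy [<-]]//|x];
    exists x.
- by rewrite (_ : _ @^-1` _ = set0) ?open0//; apply/seteqP; split.
Qed.

Lemma open_Rbot_subbase (U : set (Rbot R)) : Rbot_subbase U -> open U.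
Proof.
move=> bU; exists [set U]; last by rewrite bigcup_set1.
move=> _ ->; exists [fset U]%fset; last by rewrite set_fset1 bigcap_set1.
by move=> V /fset1P ->; exact: mem_set.
Qed.

Lemma open_measurable_Rbot (U : set (Rbot R)) : open U -> measurable U.
Proof. exact: sub_sigma_algebra. Qed.

Lemma measurable_bot : measurable [set None : Rbot R].
Proof.
by apply: open_measurable_Rbot; apply: open_Rbot_subbase; exact: or_intror.
Qed.

Lemma measurable_real : measurable_fun setT (@real_ R).
Proof.
apply: (@measurability _ _ _ _ _ _ [set U : set (Rbot R) | open U]) => //.
move=> _ [U oU <-]; rewrite setTI.
apply: open_measurable; exact: open_real_preimage.
Qed.

Lemma measurable_isSome : measurable_fun setT (@isSome R : Rbot R -> bool).
Proof.
apply: (measurable_fun_bool false); rewrite setTI.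
rewrite (_ : _ @^-1` _ = [set None]); first exact: measurable_bot.
by apply/seteqP; split=> [[]//|_ -> ].
Qed.

(** Open intervals generate the Borel sets of [R]; the preimage of one is its copy under [Some],
    joined by the undefined point exactly when the default [r] lies in the interval. *)
Lemma measurable_odflt (r : R) : measurable_fun setT (@odflt R r : Rbot R -> R).
Proof.
apply: (measurability _ (RGenOpens.measurableE R)) => _ [_ [a [b ->] <-]].
set J := `]a, b[%classic; rewrite setTI.
have mJ : measurable (@Some R @` J : set (Rbot R)).
  apply: open_measurable_Rbot; apply: open_Rbot_subbase; apply: or_introl.
  by exists J => //; exact: interval_open.
case: (pselect (J r)) => Jr.
- rewrite (_ : _ @^-1` _ = Some @` J `|` [set None]).
    by apply: measurableU => //; exact: measurable_bot.
  apply/seteqP; split=> [[x|] /= Jx|_ [[x Jx <-] | ->]] //; last by right.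
  by left; exists x.
- rewrite (_ : _ @^-1` _ = Some @` J) //.
  apply/seteqP; split=> [[x|] /= Jx|_ [x Jx <-]] //.
  by exists x.
Qed.

(** Common form of [rbadd] and [rbmul], which are instances of it by conversion. *)
Definition rbmap2 (op : R -> R -> R) (a b : Rbot R) : Rbot R :=
  if a is Some r then if b is Some s then Some (op r s) else None else None.

Context d (T : measurableType d).
Implicit Types f g : T -> Rbot R.

Lemma measurable_rbmap2 (op : R -> R -> R) f g :
  (forall a b : T -> R, measurable_fun setT a -> measurable_fun setT b ->
     measurable_fun setT (fun t => op (a t) (b t))) ->
  measurable_fun setT f -> measurable_fun setT g ->
  measurable_fun setT (fun t => rbmap2 op (f t) (g t)).
Proof.
move=> mop mf mg.
(* The default 0 makes both arguments total real functions; the guard discards the points where it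
   is used. *)
rewrite (_ : (fun t => _) = fun t => if isSome (f t) && isSome (g t)
    then real_ (op (odflt 0%R (f t)) (odflt 0%R (g t))) else None); last first.
  by apply/funext => t; rewrite /rbmap2; case: (f t) (g t) => [r|] [s|].
apply: measurable_fun_ifT => //.
- by apply: measurable_and; exact: measurableT_comp measurable_isSome _.
- apply: (measurableT_comp measurable_real); apply: mop.
  + exact: measurableT_comp (measurable_odflt _) mf.
  + exact: measurableT_comp (measurable_odflt _) mg.
Qed.

Lemma measurable_rbadd f g : measurable_fun setT f -> measurable_fun setT g ->
  measurable_fun setT (fun t => rbadd (f t) (g t)).
Proof. by apply: (@measurable_rbmap2 (@GRing.add R)) => a b; exact: measurable_funD. Qed.

Lemma measurable_rbmul f g : measurable_fun setT f -> measurable_fun setT g ->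
  measurable_fun setT (fun t => rbmul (f t) (g t)).
Proof. by apply: (@measurable_rbmap2 (@GRing.mul R)) => a b; exact: measurable_funM. Qed.

End measurable_Rbot.

Lemma measurable_hat_val (R : realType) (V : variables) (x : V) :
  measurable_fun setT (fun v : hat R V => v x).
Proof.
by move=> _ A mA; apply: sub_sigma_algebra; exists x => //; exists A.
Qed.

Lemma measurable_if_measurable (R : realType) (V : variables)
    (c : hat R V -> Rbot R) : measurable_fun setT (if_measurable c).
Proof. by rewrite /if_measurable; case: asboolP. Qed.

Lemma measurable_tsem (R : realType) (V : variables) (F : nat -> Type)
    (I : interpretation R F) (t : term R V F) : measurable_fun setT (tsem I t).
Proof.
(* Induction on [term] alone, not mutual with [formula]: for [TIota] the cut-off yields
   measurability whatever the semantics of [phi]. *)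
elim: t => [c|x|t1 IH1 t2 IH2|t1 IH1 t2 IH2|d f ts IH|t1 _|x t1 _|d i phi] /=.
- exact: measurable_cst.
- exact: measurable_hat_val.
- exact: measurable_rbmul.
- exact: measurable_rbadd.
- apply: (measurableT_comp (fint_measurable I f)).
  apply/measurable_fun_tnthP => i.
  by apply: eq_measurable_fun (IH i) => v _ /=; rewrite tnth_mktuple.
- exact: measurable_if_measurable.
- exact: measurable_if_measurable.
- exact: measurable_if_measurable.
Qed.

Lemma measurable_vsem (R : realType) (V : variables) (F : nat -> Type)
    (I : interpretation R F) (t : term R V F) : measurable_fun setT (vsem I t).
Proof.
move=> _ A mA; rewrite setTI.
(* Measurability in [Val] unfolds to that of the preimage under [Running], along which [vsem I t]
   becomes [tsem I t]. *)
exact: (measurable_tsem R V F I t measurableT A mA).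
Qed.

Theorem theorem1 (R : realType) (V : variables) (F : nat -> Type)
  (d : measure_display) (Omega : measurableType d) (P : probability Omega R)
  (I : interpretation R F) (z : Omega -> Val R V) (hz : measurable_fun setT z)
  (theta : term R V F) :
  measurable_fun setT (fun w : Omega => vsem I theta (z w)).
Proof. exact: measurableT_comp (measurable_vsem R V F I theta) hz. Qed.
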